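(* Let $d\ge 2$ be an integer. The following functions on $\mathcal{D}(\mathbb{C}^d)$ are concave: (i) the entropy power $\rho\mapsto E_c(\rho)=e^{cH(\rho)}$, for every real $c$ with $0\le c\le 1/(\log d)^2$; (ii) the entropy photon number $\rho\mapsto N_c(\rho)=g^{-1}(cH(\rho))$, for every real $c$ with $0\le c\le 1/(d-1)$.
   Context: $\mathcal{D}(\mathbb{C}^d)$ is the (convex) set of $d\times d$ complex positive semidefinite matrices of trace $1$. $\log$ is the natural logarithm. $H(\rho):=-\operatorname{Tr}(\rho\log\rho)=-\sum_{i=1}^d\lambda_i\log\lambda_i$ is the von Neumann entropy, where $\lambda_1,\dots,\lambda_d$ are the eigenvalues of $\rho$ and $0\log 0:=0$. The function $g:[0,\infty)\to[0,\infty)$ is $g(x):=(x+1)\log(x+1)-x\log x$ (with $g(0)=0$); it is a strictly increasing bijection, and $g^{-1}:[0,\infty)\to[0,\infty)$ is its inverse. *)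

(* Defs.v *)
From HB Require Import structures.
From mathcomp Require Import all_boot all_order all_algebra.
From mathcomp Require Import complex.
From mathcomp Require Import all_classical all_reals all_analysis.

Set Implicit Arguments.
Unset Strict Implicit.
Unset Printing Implicit Defensive.
Import Order.TTheory GRing.Theory Num.Theory.

Local Open Scope classical_set_scope.
Local Open Scope ring_scope.
Local Open Scope complex_scope.
Local Open Scope sesquilinear_scope.

(* The order of [R[i]] is partial: [0 <= z] means that [z] is real and
   nonnegative. *)
Definition psdmx (R : realType) (d : nat) (A : 'M[R[i]]_d) : Prop :=
  A \is hermsymmx /\
  forall v : 'cV[R[i]]_d, 0 <= (v ^t* *m A *m v) ord0 ord0.

Definition density (R : realType) (d : nat) : set 'M[R[i]]_d :=
  [set rho | psdmx rho /\ \tr rho = 1].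

(* [spectral_diag rho] is the row of eigenvalues, with multiplicity, of a
   normal matrix; they are real when [rho] is Hermitian, hence [complex.Re].
   The convention 0 log 0 = 0 is automatic. *)
Definition vonNeumann_entropy (R : realType) (d : nat) (rho : 'M[R[i]]_d) : R :=
  - \sum_(i < d) (let l := complex.Re (spectral_diag rho ord0 i) in l * ln l).

(* [x * ln x] is 0 at [x = 0], so [gfun 0 = 0]. *)
Definition gfun (R : realType) (x : R) : R :=
  (x + 1) * ln (x + 1) - x * ln x.

(* Inverse of the bijection [gfun] of [0, +oo[; the default value 0 is only
   taken outside the image [0, +oo[. *)
Definition gfun_inv (R : realType) : R -> R :=
  'pinv_(fun=> 0) [set x : R | 0 <= x] (@gfun R).

Definition entropy_power (R : realType) (d : nat) (c : R) (rho : 'M[R[i]]_d) : R :=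
  expR (c * vonNeumann_entropy rho).

Definition entropy_photon_number (R : realType) (d : nat) (c : R)
    (rho : 'M[R[i]]_d) : R :=
  gfun_inv (c * vonNeumann_entropy rho).

(* The library's [convex_function] requires a module over [R], whereas complex
   matrices form a module over [R[i]]: real weights are embedded by [_%:C]. *)
Definition concave_on (R : realType) (V : lmodType R[i]) (D : set V)
    (f : V -> R) : Prop :=
  forall (x y : V) (t : R), D x -> D y -> 0 <= t <= 1 ->
    t * f x + (1 - t) * f y <= f (t%:C *: x + (1 - t)%:C *: y).

(* Main.v *)
Require Import Defs.
From mathcomp Require Import all_boot all_order all_algebra.
From mathcomp Require Import complex.
From mathcomp Require Import all_classical all_reals all_analysis.
From mathcomp Require Import ring lra.
Import Order.TTheory GRing.Theory Num.Theory.
Import numFieldTopology.Exports numFieldNormedType.Exports.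
Local Open Scope classical_set_scope.
Local Open Scope ring_scope.
Local Open Scope complex_scope.
Local Open Scope sesquilinear_scope.

(** Both functions are [phi (H rho)] with [phi] nondecreasing.  In an eigenbasis
    of [z = t x + (1 - t) y], the diagonals [q] and [r] of [x] and [y] are
    probability vectors with larger entropies and [t q + (1 - t) r] is the
    spectrum of [z], so it suffices to treat the Shannon entropy.

    Along a segment with velocity [D], [H'' = - sum D_i^2 / p_i], and by
    Cauchy-Schwarz [H'^2 <= V * sum D_i^2 / p_i] with [V] the variance of
    [ln p]; hence [phi o H] is concave as soon as [V phi''(H) <= phi'(H)].

    For the entropy power this reads [c V <= 1], and [V <= (ln d)^2].

    For the photon number it reads [c V <= w(N)] where [g(N) = c H] and
    [w(N) = N (N + 1) ln(1 + 1/N)^2] is the variance of the information of the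
    geometric law of mean [N] (whose entropy is [g(N)]).  Sort [p] and add its
    entries one at a time in decreasing order: when [x] joins entries of total
    mass [Q], the gain in [V] is at most [x Q (ln x)^2 <= w(x Q)], while the gain
    in entropy is at least [g(x Q)].  So [V] is at most a sum of [d - 1] values
    [w(M_j)] with [sum g(M_j) <= H], and [w o g^-1] is concave. *)

(** * Calculus tools and elementary bounds on the logarithm *)

Lemma mean_value {R : realType} {f df : R -> R} {a b : R} : a < b ->
  (forall x, a <= x <= b -> is_derive x 1 f (df x)) ->
  exists2 x, a < x < b & f b - f a = df x * (b - a).
Proof.
move=> ab fD; have [||x xab E] := @MVT R f df a b ab.
- by move=> x; rewrite in_itv => /andP[/ltW ax /ltW xb]; apply: fD; rewrite ax.
- apply: derivable_within_continuous => x; rewrite in_itv => xab.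
  exact: (@ex_derive _ _ _ _ _ _ _ (fD x xab)).
- by exists x => //; move: xab; rewrite in_itv.
Qed.

Lemma ler_derive_ge0 {R : realType} {f df : R -> R} {a b : R} : a <= b ->
  (forall x, a <= x <= b -> is_derive x 1 f (df x)) ->
  (forall x, a < x < b -> 0 <= df x) -> f a <= f b.
Proof.
rewrite le_eqVlt => /predU1P[-> //|ab] fD df0.
have [x xab E] := mean_value ab fD.
by rewrite -subr_ge0 E mulr_ge0 ?df0// subr_ge0 ltW.
Qed.

(** Both sides vanish at 1, and their difference has derivative [(x - 1)^2 / (x (x + 1)^2)]. The
    left side is the first-order Padé approximant of [ln] at 1. *)
Lemma ln_ge_pade {R : realType} (u : R) : 1 <= u -> 2 * (u - 1) / (u + 1) <= ln u.
Proof.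
move=> u1; pose f (x : R) := ln x - 2 * (x - 1) / (x + 1).
pose df (x : R) := x^-1 - (2 * (x + 1)^-1 - 2 * (x - 1) * (x + 1)^-2).
suff: f 1 <= f u by rewrite /f ln1 subrr mulr0 mul0r subr0 subr_ge0.
apply: (@ler_derive_ge0 _ _ df _ _ u1) => x /andP[x1 _].
  have x0 : 0 < x by lra.
  have x10 : x + 1 != 0 by lra.
  have fD : is_derive x 1 (fun y => (y + 1)^-1) (- (x + 1) ^- 2 * (1 + 0)).
    exact: (@is_deriveV _ (fun y => y + 1)).
  apply: (is_derive_eq (is_deriveB (is_derive1_ln x0) (is_deriveM _ fD))).
  rewrite /df /GRing.scale /= ?fctE /=; field; lra.
have -> : df x = (x - 1) ^+ 2 / (x * (x + 1) ^+ 2).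
  by rewrite /df; field; lra.
by rewrite divr_ge0 ?sqr_ge0// mulr_ge0 ?sqr_ge0//; lra.
Qed.

(** With [u = e^s] this is [s <= sinh s]; the derivative of the difference is a square over 2. *)
Lemma ln_le_half_subV {R : realType} (u : R) : 1 <= u -> ln u <= (u - u^-1) / 2.
Proof.
move=> u1; pose f (x : R) := (x - x^-1) / 2 - ln x.
pose df (x : R) := (1 + x^-2) / 2 - x^-1.
suff: f 1 <= f u by rewrite /f ln1 invr1 subrr mul0r subr0 subr_ge0.
apply: (@ler_derive_ge0 _ _ df _ _ u1) => x /andP[x1 _].
  have x0 : 0 < x by lra.
  have x10 : x != 0 by lra.
  have fD : is_derive x 1 (fun y => y^-1) (- x ^- 2 * 1).
    exact: (@is_deriveV _ id).
  apply: (is_derive_eq (is_deriveB (is_deriveM (is_deriveB _ fD) _) (is_derive1_ln x0))).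
  by rewrite /df /GRing.scale /= ?fctE /=; field.
have -> : df x = ((x - 1) / x) ^+ 2 / 2.
  by rewrite /df; field; lra.
by rewrite divr_ge0 ?sqr_ge0.
Qed.

Lemma ln_le_subr1 {R : realType} (x : R) : 0 < x -> ln x <= x - 1.
Proof.
by move=> x0; have := @le_ln1Dx R (x - 1); rewrite (addrC 1) subrK; apply; lra.
Qed.

(** The left side is the tangent at [a] of the convex function [x ln x]. It follows from
    [ln (a / x) <= a / x - 1] after multiplication by [x]. *)
Lemma xlnx_tangent {R : realType} (x a : R) :
  0 <= x -> 0 < a -> x * ln a + x - a <= x * ln x.
Proof.
rewrite le_eqVlt => /predU1P[<- a0|x0 a0]; first by rewrite !mul0r; lra.
have := ln_le_subr1 _ (divr_gt0 a0 x0); rewrite ln_div ?posrE// => H.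
have := ler_wpM2l (ltW x0) H.
have -> : x * (a / x - 1) = a - x by field; rewrite gt_eqF.
by rewrite mulrBr; lra.
Qed.

Lemma xlnx_jensen {R : realType} {I : finType} (w x : I -> R) :
  (forall i, 0 <= w i) -> \sum_i w i = 1 -> (forall i, 0 <= x i) ->
  (\sum_i w i * x i) * ln (\sum_i w i * x i) <= \sum_i w i * (x i * ln (x i)).
Proof.
move=> w0 w1 x0; set a := \sum_i _.
have a0 : 0 <= a by apply: sumr_ge0 => i _; apply: mulr_ge0.
have [a00|aN0] := eqVneq a 0.
  rewrite a00 mul0r big1// => i _.
  have /psumr_eq0P-/(_ a00 i isT) : forall i, true -> 0 <= w i * x i.
    by move=> j _; rewrite mulr_ge0.
  by rewrite mulrA => ->; rewrite mul0r.
have ap : 0 < a by rewrite lt_def aN0.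
have -> : a * ln a = \sum_i w i * (x i * ln a + x i - a).
  under eq_bigr do rewrite mulrBr mulrDr mulrA.
  by rewrite big_split big_split /= -!mulr_suml sumrN -mulr_suml w1 -/a; lra.
by apply: ler_sum => i _; rewrite ler_wpM2l// xlnx_tangent.
Qed.

Lemma gfunE {R : realType} (x : R) : gfun x = (1 + x) * ln (1 + x) - x * ln x.
Proof. by rewrite /gfun (addrC x). Qed.

(** * The entropy gained by joining two masses, bounded below through [gfun] *)

(** Since [a - a^2 = b - b^2 = x] with [x = a b], the terms in [x ln x] cancel and the claim becomes
    [(1 + x) ln (1 + x) <= - a^2 ln a - b^2 ln b]. Jensen bounds the right side below by
    [- (1 - 2 x) ln m], and rational bounds on the two remaining logarithms reduce everything to
    [key]. *)
Lemma gfun_le_binary_entropy {R : realType} (a b : R) : 0 < a -> 0 < b ->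
  a + b = 1 -> gfun (a * b) <= - (a * ln a) - b * ln b.
Proof.
move=> a0 b0 ab; rewrite gfunE lnM ?posrE//; set x := a * b.
have bE : b = 1 - a by lra.
have x4 : x <= 1 / 4.
  by rewrite /x bE; have := sqr_ge0 (a - 1 / 2); rewrite expr2; nra.
have x0 : 0 < x by rewrite mulr_gt0.
pose m := (1 - 3 * x) / (1 - 2 * x).
have m0 : 0 < m by rewrite divr_gt0; lra.
(* Jensen for the concave [ln] with weights [a ^+ 2], [b ^+ 2], whose mean is [m]. *)
have lnm : a ^+ 2 * ln a + b ^+ 2 * ln b <= (1 - 2 * x) * ln m.
  have tgt c : 0 < c -> ln c <= ln m + c / m - 1.
    move=> c0; have := ln_le_subr1 _ (divr_gt0 c0 m0).
    by rewrite ln_div ?posrE//; lra.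
  have := lerD (ler_wpM2l (sqr_ge0 a) (tgt a a0)) (ler_wpM2l (sqr_ge0 b) (tgt b b0)).
  suff -> : a ^+ 2 * (ln m + a / m - 1) + b ^+ 2 * (ln m + b / m - 1) =
            (1 - 2 * x) * ln m by [].
  have -> : a ^+ 2 * (ln m + a / m - 1) + b ^+ 2 * (ln m + b / m - 1) =
    (a ^+ 2 + b ^+ 2) * (ln m - 1) + (a ^+ 3 + b ^+ 3) / m by ring.
  have -> : a ^+ 2 + b ^+ 2 = 1 - 2 * x by rewrite /x bE; ring.
  have -> : a ^+ 3 + b ^+ 3 = 1 - 3 * x by rewrite /x bE; ring.
  by rewrite /m; field; apply/andP; split; lra.
have lnmV : 2 * x / (2 - 5 * x) <= - ln m.
  rewrite -lnV ?posrE// /m invf_div.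
  have u1 : 1 <= (1 - 2 * x) / (1 - 3 * x) by rewrite ler_pdivlMr; lra.
  apply: le_trans (ln_ge_pade _ u1).
  rewrite le_eqVlt; apply/orP; left; apply/eqP; field.
  by do ?[apply/andP; split]; lra.
have ln1x : (1 + x) * ln (1 + x) <= x + x ^+ 2 / 2.
  have u1 : 1 <= 1 + x by lra.
  have := ler_wpM2l (_ : 0 <= 1 + x) (ln_le_half_subV _ u1) => /(_ ltac:(lra)).
  by congr (_ <= _); field; lra.
(* Once the denominator is cleared, the two sides differ by exactly [5 x^3 / 2]. *)
have key : x + x ^+ 2 / 2 <= (1 - 2 * x) * (2 * x / (2 - 5 * x)).
  rewrite mulrA ler_pdivlMr; last by lra.
  have := exprn_ge0 3 (ltW x0); rewrite !exprS expr0; lra.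
have := ler_wpM2l (_ : 0 <= 1 - 2 * x) lnmV => /(_ ltac:(lra)).
have -> : x * (ln a + ln b) = a * ln a + b * ln b - (a ^+ 2 * ln a + b ^+ 2 * ln b).
  by rewrite /x bE; ring.
by lra.
Qed.

(** By convexity [(1 + z) ln (1 + z)] is at most [q^2] times its value at [y]. What remains is that
    [(q - q^2) gfun y] dominates [- 2 q^2 y ln q], which is at most [2 (q - q^2) y]; and
    [gfun y >= 2 y] because [(1 + y) ln (1 + y) >= y] and [- ln y >= 1]. *)
Lemma gfun_sqr_scale {R : realType} (q y : R) : 0 < q <= 1 -> 0 < y <= 1 / 4 ->
  gfun (q ^+ 2 * y) <= q * gfun y.
Proof.
move=> /andP[q0 q1] /andP[y0 y4].
have q20 : 0 < q ^+ 2 by rewrite exprn_gt0.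
have q21 : q ^+ 2 <= q by rewrite expr2 ger_pMr.
set z := q ^+ 2 * y; have z0 : 0 < z by rewrite mulr_gt0.
rewrite !gfunE {3}/z lnM ?posrE// lnXn//.
have cvx : (1 + z) * ln (1 + z) <= q ^+ 2 * ((1 + y) * ln (1 + y)).
  have a0 : 0 < 1 + z by lra.
  have H1 := xlnx_tangent (1 + y) (1 + z) ltac:(lra) a0.
  have H2 := xlnx_tangent 1 (1 + z) ltac:(lra) a0; rewrite ln1 in H2.
  have := lerD (ler_wpM2l (ltW q20) H1) (ler_wpM2l (_ : 0 <= 1 - q ^+ 2) H2).
  by move=> /(_ ltac:(lra)); rewrite /z; lra.
have yge : y <= (1 + y) * ln (1 + y).
  by have := xlnx_tangent (1 + y) 1 ltac:(lra) ltac:(lra); rewrite ln1; lra.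
have lny : 1 <= - ln y.
  rewrite -lnV ?posrE//; have yV : 1 <= y^-1 by rewrite invf_ge1//; lra.
  apply: le_trans (ln_ge_pade _ yV).
  have -> : 2 * (y^-1 - 1) / (y^-1 + 1) = 2 * (1 - y) / (1 + y).
    by field; apply/andP; split; lra.
  by rewrite ler_pdivlMr; lra.
have lnq : q - 1 <= q * ln q by have := xlnx_tangent q 1 (ltW q0) ltr01; rewrite ln1; lra.
have qq : 0 <= q - q ^+ 2 by lra.
have H1 := ler_wpM2l qq yge.
have H2 := ler_wpM2l (mulr_ge0 qq (ltW y0)) lny.
have H3 := ler_wpM2l (mulr_ge0 (ltW q0) (ltW y0)) lnq.
have -> : z * (ln q *+ 2 + ln y) = 2 * (q * y * (q * ln q)) + q ^+ 2 * y * ln y.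
  by rewrite /z; ring.
by lra.
Qed.

Lemma gfun0 {R : realType} : gfun 0 = 0 :> R.
Proof. by rewrite /gfun add0r ln1 mulr0 mul0r subrr. Qed.

(** The right side is [q = a + b] times the binary entropy of [a / q] and [b / q], while the product
    scales by [q^2]. The two preceding lemmas therefore combine, a product of two numbers of sum 1
    being at most 1/4. *)
Lemma gfun_mul_le {R : realType} (a b : R) : 0 <= a -> 0 <= b -> a + b <= 1 ->
  gfun (a * b) <= (a + b) * ln (a + b) - a * ln a - b * ln b.
Proof.
rewrite le_eqVlt => /predU1P[<- b0 _|a0]; first by rewrite !mul0r gfun0 add0r; lra.
rewrite le_eqVlt => /predU1P[<- _|b0 ab]; first by rewrite mul0r !mulr0 gfun0 addr0; lra.
set q := a + b; have q0 : 0 < q by rewrite /q; lra.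
have qN0 : q != 0 by rewrite gt_eqF.
pose al := a / q; pose be := b / q.
have al0 : 0 < al by rewrite divr_gt0.
have be0 : 0 < be by rewrite divr_gt0.
have albe : al + be = 1 by rewrite /al /be -mulrDl divff.
have -> : a * b = q ^+ 2 * (al * be) by rewrite /al /be; field.
have H : al * be <= 1 / 4.
  have -> : be = 1 - al by lra.
  by have := sqr_ge0 (al - 1 / 2); rewrite expr2; lra.
apply: le_trans (gfun_sqr_scale q (al * be) _ _) _; rewrite ?q0 ?(mulr_gt0 al0 be0)//.
have := ler_wpM2l (ltW q0) (gfun_le_binary_entropy al be al0 be0 albe).
rewrite {3}/al {3}/be !ln_div ?posrE// => H2; apply: le_trans H2 _.
have -> : q * (- (al * (ln a - ln q)) - be * (ln b - ln q)) =
  (q * al + q * be) * ln q - (q * al) * ln a - (q * be) * ln b by ring.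
by rewrite /al /be ![q * (_ / q)]mulrC !divfK.
Qed.

(** * The varentropy of the geometric law *)

Definition dgfun {R : realType} (x : R) : R := ln (x + 1) - ln x.

Definition geom_var {R : realType} (x : R) : R := x * (x + 1) * dgfun x ^+ 2.

(* The derivative of [geom_var] with respect to [gfun]. *)
Definition geom_slope {R : realType} (x : R) : R := (2 * x + 1) * dgfun x - 2.

Lemma dgfunE {R : realType} (x : R) : 0 < x -> dgfun x = ln ((x + 1) / x).
Proof. by move=> x0; rewrite ln_div ?posrE// addr_gt0. Qed.

Lemma succ_div_ge1 {R : realType} (x : R) : 0 < x -> 1 <= (x + 1) / x.
Proof. by move=> x0; rewrite ler_pdivlMr// mul1r; lra. Qed.

Lemma dgfun_gt0 {R : realType} (x : R) : 0 < x -> 0 < dgfun x.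
Proof. by move=> x0; rewrite subr_gt0 ltr_ln ?posrE//; lra. Qed.

(** At [u = (x + 1) / x] the Padé bound is exactly [2 / (2 x + 1)]. This is the nonnegativity of
    [geom_slope]. *)
Lemma dgfun_ge {R : realType} (x : R) : 0 < x -> 2 <= (2 * x + 1) * dgfun x.
Proof.
move=> x0; rewrite dgfunE// mulrC -ler_pdivrMr; last by lra.
apply: le_trans (ln_ge_pade _ (succ_div_ge1 x x0)).
by rewrite le_eqVlt; apply/orP; left; apply/eqP; field; rewrite !gt_eqF//; lra.
Qed.

(** The bound [ln_le_half_subV] at the same point; it makes the derivative of [geom_slope]
    nonpositive. *)
Lemma dgfun_le {R : realType} (x : R) :
  0 < x -> 2 * (x * (x + 1) * dgfun x) <= 2 * x + 1.
Proof.
move=> x0; rewrite dgfunE//.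
have xx : 0 < 2 * (x * (x + 1)) by do ?[apply: mulr_gt0]; lra.
have := ler_wpM2l (ltW xx) (ln_le_half_subV _ (succ_div_ge1 x x0)).
rewrite invf_div -!mulrA => /le_trans; apply.
by rewrite le_eqVlt; apply/orP; left; apply/eqP; field; rewrite !gt_eqF//; lra.
Qed.

Lemma mul_dgfun_le1 {R : realType} (x : R) : 0 < x -> x * dgfun x <= 1.
Proof.
move=> x0; rewrite dgfunE//.
have := ler_wpM2l (ltW x0) (ln_le_subr1 _ (lt_le_trans ltr01 (succ_div_ge1 x x0))).
by move=> /le_trans; apply; rewrite mulrBr mulrC divfK ?gt_eqF//; lra.
Qed.

Lemma is_derive_succ {R : realType} (x : R) : is_derive x 1 (fun y : R => y + 1) 1.
Proof.
apply: (is_derive_eq (is_deriveD (is_derive_id x 1) (is_derive_cst (1 : R) x 1))).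
by rewrite addr0.
Qed.

Lemma is_derive_ln_succ {R : realType} (x : R) :
  0 < x + 1 -> is_derive x 1 (fun y => ln (y + 1)) (x + 1)^-1.
Proof.
move=> x0; rewrite -[_^-1]mulr1.
exact: (@is_derive1_comp _ (@ln R) (fun y => y + 1) _ _ _
         (is_derive1_ln x0) (is_derive_succ x)).
Qed.

Lemma is_derive_dgfun {R : realType} (x : R) :
  0 < x -> is_derive x 1 dgfun (- (x * (x + 1))^-1).
Proof.
move=> x0; have x10 : 0 < x + 1 by lra.
apply: (is_derive_eq (is_deriveB (is_derive_ln_succ x x10) (is_derive1_ln x0))).
by field; rewrite !gt_eqF.
Qed.

Lemma is_derive_gfun {R : realType} (x : R) : 0 < x -> is_derive x 1 (@gfun R) (dgfun x).
Proof.
move=> x0; have x10 : 0 < x + 1 by lra.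
apply: (is_derive_eq (is_deriveB
  (is_deriveM (is_derive_succ x) (is_derive_ln_succ x x10))
  (is_deriveM (is_derive_id x 1) (is_derive1_ln x0)))).
by rewrite /dgfun /GRing.scale /=; field; rewrite !gt_eqF.
Qed.

Lemma is_derive_geom_var {R : realType} (x : R) :
  0 < x -> is_derive x 1 geom_var (geom_slope x * dgfun x).
Proof.
move=> x0; have x10 : 0 < x + 1 by lra.
apply: (is_derive_eq (is_deriveM (is_deriveM (is_derive_id x 1) (is_derive_succ x))
                     (is_deriveX 2 (is_derive_dgfun x x0)))).
by rewrite /geom_slope /GRing.scale /= !fctE /=; field; rewrite !gt_eqF.
Qed.

Lemma is_derive_geom_slope {R : realType} (x : R) : 0 < x ->
  is_derive x 1 geom_slope (2 * dgfun x - (2 * x + 1) / (x * (x + 1))).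
Proof.
move=> x0; have x10 : 0 < x + 1 by lra.
apply: (is_derive_eq (is_deriveB (is_deriveM _ (is_derive_dgfun x x0)) _)).
by rewrite /GRing.scale /= ?fctE /=; field; rewrite !gt_eqF.
Qed.

Lemma geom_slope_ge0 {R : realType} (x : R) : 0 < x -> 0 <= geom_slope x.
Proof. by move=> x0; have := dgfun_ge x x0; rewrite /geom_slope; lra. Qed.

Lemma geom_slope_antitone {R : realType} (x y : R) :
  0 < x -> x <= y -> geom_slope y <= geom_slope x.
Proof.
move=> x0 xy; rewrite -lerN2.
pose df (z : R) := - (2 * dgfun z - (2 * z + 1) / (z * (z + 1))).
apply: (@ler_derive_ge0 _ (fun z => - geom_slope z) df _ _ xy) => z /andP[xz _].
  by have z0 : 0 < z by [lra]; exact: (is_deriveN (is_derive_geom_slope z z0)).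
have z0 : 0 < z by lra.
have zz : 0 < z * (z + 1) by apply: mulr_gt0; lra.
by rewrite /df opprB subr_ge0 ler_pdivlMr//; have := dgfun_le z z0; lra.
Qed.

(** [geom_slope] decreases, so [geom_var] is a concave function of [gfun] and lies below its
    tangents. Concretely, [f] increases before [x] and decreases after it. *)
Lemma geom_var_tangent {R : realType} (x y : R) : 0 < x -> 0 < y ->
  geom_var y <= geom_var x + geom_slope x * (gfun y - gfun x).
Proof.
move=> x0 y0; pose f z := geom_var z - geom_slope x * gfun z.
pose df z := (geom_slope z - geom_slope x) * dgfun z.
have fD (z : R) : 0 < z -> is_derive z 1 f (df z).
  move=> z0; apply: (is_derive_eq (is_deriveB (is_derive_geom_var z z0)
    (is_deriveZ (geom_slope x) (is_derive_gfun z z0)))).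
  by rewrite /df /GRing.scale /=; ring.
suff : f y <= f x by rewrite /f; lra.
have [xy|yx] := leP x y.
  rewrite -lerN2.
  apply: (@ler_derive_ge0 _ (fun z => - f z) (fun z => - df z) _ _ xy) => z.
    move=> /andP[xz _].
    by have z0 : 0 < z by [lra]; exact: (is_deriveN (fD z z0)).
  move=> /andP[xz _]; have z0 : 0 < z by lra.
  rewrite /df -mulNr mulr_ge0 ?(ltW (dgfun_gt0 z z0))// opprB subr_ge0.
  by rewrite geom_slope_antitone// ltW.
apply: (@ler_derive_ge0 _ _ df _ _ (ltW yx)) => z /andP[yz zx].
  by apply: fD; lra.
have z0 : 0 < z by lra.
rewrite /df mulr_ge0 ?(ltW (dgfun_gt0 z z0))// subr_ge0.
by rewrite geom_slope_antitone// ltW.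
Qed.

(** The tangent of the preceding lemma has a nonnegative value at entropy 0. This constant is paid
    once for each added entry. *)
Lemma geom_var_ge_slope {R : realType} (x : R) :
  0 < x -> geom_slope x * gfun x <= geom_var x.
Proof.
move=> x0; set A := ln (x + 1); set L := dgfun x.
have A0 : 0 <= A by apply: ln_ge0; lra.
have Ax : A <= x by have := ln_le_subr1 (x + 1) ltac:(lra); rewrite -/A; lra.
have xL : x * L <= 1 := mul_dgfun_le1 x x0.
have L0 : 0 < L := dgfun_gt0 x x0.
have xL1 : 0 <= 1 - x * L by rewrite subr_ge0.
have xA0 : 0 <= x - A by rewrite subr_ge0.
(* The difference of the two sides is the left-hand product in [H1], plus that in [H2], plus twice
   that in [H3]. *)
have H1 := mulr_ge0 (ltW (mulr_gt0 x0 L0)) xL1.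
have H2 := mulr_ge0 xA0 (ltW L0).
have H3 := mulr_ge0 A0 xL1.
have -> : gfun x = A + x * L by rewrite /gfun /L /dgfun -/A; ring.
by rewrite /geom_var /geom_slope -/L; lra.
Qed.

Lemma geom_var_ge {R : realType} (x p : R) :
  0 < x -> x <= p -> p <= 1 -> x * ln p ^+ 2 <= geom_var x.
Proof.
move=> x0 xp p1; have p0 : 0 < p by lra.
have lnp : - ln p <= dgfun x.
  have l0 : 0 <= ln (x + 1) by apply: ln_ge0; lra.
  have : ln x <= ln p by rewrite ler_ln.
  by rewrite /dgfun; lra.
have lnp0 : 0 <= - ln p by rewrite oppr_ge0 ln_le0.
have lnp2 : (- ln p) ^+ 2 <= dgfun x ^+ 2.
  by rewrite lerXn2r ?nnegrE// ltW// dgfun_gt0.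
rewrite /geom_var -mulrA ler_wpM2l ?(ltW x0)// -[ln p ^+ 2]sqrrN.
by apply: le_trans lnp2 _; rewrite ler_peMl ?sqr_ge0//; lra.
Qed.

(** * Bounds on the variance of the log-likelihood *)

Definition logvar {R : realType} {I : finType} (p : I -> R) : R :=
  \sum_i p i * ln (p i) ^+ 2 - (\sum_i p i * ln (p i)) ^+ 2.

(** The number is split into factors close to 1, where the rational bounds are sharp: 24/35 is the
    sum of 2/7 and 2/5. The bound on [ln 3] is obtained in the same way. *)
Lemma ln2_ge {R : realType} : 24 / 35 <= ln (2 : R).
Proof.
have -> : 2 = (4 / 3) * (3 / 2) :> R by field.
have lb (u q : R) : 1 <= u -> q * (u + 1) <= 2 * (u - 1) -> q <= ln u.
  move=> u1 h; apply: le_trans (ln_ge_pade u u1).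
  by rewrite ler_pdivlMr//; lra.
have H1 := lb (4 / 3) (2 / 7) ltac:(lra) ltac:(lra).
have H2 := lb (3 / 2) (2 / 5) ltac:(lra) ltac:(lra).
rewrite lnM ?posrE; lra.
Qed.

Lemma ln3_le {R : realType} : ln (3 : R) <= 1106 / 1000.
Proof.
have -> : 3 = ((5 / 4) * (6 / 5)) ^+ 2 * ((7 / 6) * (8 / 7)) :> R by field.
have ub (u q : R) : 1 <= u -> u * u - 1 <= 2 * q * u -> ln u <= q.
  move=> u1 h; have u0 : 0 < u by lra.
  apply: le_trans (ln_le_half_subV u u1) _.
  rewrite -(ler_pM2r u0) (_ : _ / 2 * u = (u * u - 1) / 2); first by lra.
  by field; rewrite gt_eqF.
have H1 := ub (5 / 4) (9 / 40) ltac:(lra) ltac:(lra).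
have H2 := ub (6 / 5) (11 / 60) ltac:(lra) ltac:(lra).
have H3 := ub (7 / 6) (13 / 84) ltac:(lra) ltac:(lra).
have H4 := ub (8 / 7) (15 / 112) ltac:(lra) ltac:(lra).
have lnMp (u v : R) : 0 < u -> 0 < v -> ln (u * v) = ln u + ln v.
  by move=> u0 v0; rewrite lnM.
rewrite lnMp ?lnXn; [|lra|lra|lra].
rewrite (lnMp (5 / 4) (6 / 5)) ?(lnMp (7 / 6) (8 / 7)); lra.
Qed.

(* Tangent of [z ln z] at [1/3], near the maximum of [- z ln z / (1 + z ^+ 2)]. *)
Lemma oppr_xlnx_le {R : realType} (z : R) : 0 < z -> - (2 * (z * ln z)) <= ln 2 * (1 + z ^+ 2).
Proof.
move=> z0; have := xlnx_tangent z (1 / 3) (ltW z0) ltac:(lra).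
rewrite div1r lnV ?posrE; last by lra.
have := ler_wpM2l (ltW z0) (@ln3_le R).
have z2 : 0 <= 1 + z ^+ 2 by have := sqr_ge0 z; lra.
have := ler_wpM2r z2 (@ln2_ge R).
have := sqr_ge0 (z - 155 / 1000); rewrite !expr2; lra.
Qed.

(** Both sides are symmetric. For [0 < b <= a] and [z = sqrt (b / a)], the claim is [a^2] times the
    square of the preceding inequality. *)
Lemma mul_ln_ratio_sqr_le {R : realType} (a b : R) : 0 <= a -> 0 <= b ->
  a * b * (ln a - ln b) ^+ 2 <= ln 2 ^+ 2 * (a + b) ^+ 2.
Proof.
wlog ba : a b / b <= a => [wl a0 b0|].
  case: (leP b a) => [|/ltW] h; first exact: wl.
  by have := wl b a h b0 a0; rewrite [b * a]mulrC [b + a]addrC -sqrrN opprB.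
move=> a0; rewrite le_eqVlt => /predU1P[<-|b0].
  by rewrite mulr0 mul0r mulr_ge0 ?sqr_ge0.
have ap : 0 < a := lt_le_trans b0 ba.
pose z := Num.sqrt (b / a); have z0 : 0 < z by rewrite sqrtr_gt0 divr_gt0.
have z2 : z ^+ 2 = b / a by rewrite sqr_sqrtr// ltW// divr_gt0.
have bE : b = a * z ^+ 2 by rewrite z2 mulrC divfK// gt_eqF.
have z1 : z <= 1.
  by rewrite -(@ler_pXn2r _ 2) ?nnegrE ?ler01 ?(ltW z0)// expr1n z2 ler_pdivrMr ?mul1r.
have lb : ln b = ln a + ln z *+ 2 by rewrite bE lnM ?posrE ?exprn_gt0// lnXn.
have -> : a * b * (ln a - ln b) ^+ 2 = a ^+ 2 * (- (2 * (z * ln z))) ^+ 2.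
  by rewrite lb bE; ring.
have -> : ln 2 ^+ 2 * (a + b) ^+ 2 = a ^+ 2 * (ln 2 * (1 + z ^+ 2)) ^+ 2 by rewrite bE; ring.
have zl : 0 <= - (2 * (z * ln z)).
  by rewrite oppr_ge0 mulr_ge0_le0// mulr_ge0_le0 ?ln_le0// ltW.
apply: ler_wpM2l; first exact: sqr_ge0.
by rewrite lerXn2r ?nnegrE ?(le_trans zl)// oppr_xlnx_le.
Qed.

(** A variance is half the mean squared difference of two independent copies. *)
Lemma logvar_pairs {R : realType} {I : finType} (p : I -> R) : \sum_i p i = 1 ->
  logvar p = 2^-1 * \sum_i \sum_j p i * p j * (ln (p i) - ln (p j)) ^+ 2.
Proof.
move=> p1; set A := \sum_i p i * ln (p i) ^+ 2; set B := \sum_i p i * ln (p i).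
have -> : \sum_i \sum_j p i * p j * (ln (p i) - ln (p j)) ^+ 2 =
    \sum_i (p i * ln (p i) ^+ 2 - 2 * B * (p i * ln (p i)) + A * p i).
  apply: eq_bigr => i _.
  have -> : p i * ln (p i) ^+ 2 - 2 * B * (p i * ln (p i)) + A * p i =
     p i * ln (p i) ^+ 2 * \sum_j p j - 2 * (p i * ln (p i)) * B + p i * A.
    by rewrite p1; ring.
  rewrite /A /B !mulr_sumr -sumrB -big_split /=; apply: eq_bigr => j _; ring.
rewrite big_split sumrB /= -!mulr_sumr p1 -/A -/B /logvar -/A -/B.
by field.
Qed.

Lemma logvar_le_pairs {R : realType} {I : finType} (p : I -> R) :
  (1 < #|I|)%N -> (forall i, 0 <= p i) -> \sum_i p i = 1 ->
  logvar p <= (#|I|%:R - 1) * ln 2 ^+ 2.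
Proof.
move=> cI p0 p1; rewrite logvar_pairs//.
set L := ln 2 ^+ 2; set S := \sum_i p i ^+ 2; set n : R := #|I|%:R.
have L0 : 0 <= L := sqr_ge0 _.
have n2 : 2 <= n by rewrite ler_nat.
have S1 : S <= 1.
  rewrite -p1; apply: ler_sum => i _; rewrite expr2 ler_piMr//.
  by rewrite -p1 (bigD1 i)//= lerDl sumr_ge0.
(* Diagonal pairs contribute nothing to the variance, so [q] removes them from the bound; without
   this the constant would exceed [#|I| - 1]. *)
pose q i j := (p i + p j) ^+ 2 - (i == j)%:R * (4 * p i ^+ 2).
have qE i : \sum_j q i j = n * p i ^+ 2 + 2 * p i + S - 4 * p i ^+ 2.
  have -> : \sum_j q i j = \sum_j (p i + p j) ^+ 2 - 4 * p i ^+ 2.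
    rewrite sumrB -mulr_suml (_ : \sum_j (i == j)%:R = 1) ?mul1r//.
    by rewrite (bigD1 i)//= eqxx big1 ?addr0// => j; rewrite eq_sym => /negPf->.
  congr (_ - _).
  have -> : \sum_j (p i + p j) ^+ 2 =
      \sum_j (p i ^+ 2 + 2 * p i * p j + p j ^+ 2).
    by apply: eq_bigr => j _; ring.
  by rewrite !big_split /= -/S sumr_const -[_ *+ #|_|]mulr_natl -mulr_sumr p1 mulr1.
have qS : \sum_i \sum_j q i j = 2 * ((n - 2) * S + 1).
  under eq_bigr do rewrite qE.
  rewrite sumrB !big_split /= -!mulr_sumr p1 -/S sumr_const -[_ *+ #|_|]mulr_natl -/n; ring.
have : \sum_i \sum_j p i * p j * (ln (p i) - ln (p j)) ^+ 2 <=
    L * \sum_i \sum_j q i j.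
  rewrite mulr_sumr; apply: ler_sum => i _; rewrite mulr_sumr.
  apply: ler_sum => j _; rewrite /q; have [->|_] := eqVneq i j.
    rewrite subrr expr0n /= mulr0 mulr_ge0//; have := sqr_ge0 (p j).
    by rewrite expr2; lra.
  by rewrite mul0r subr0 mul_ln_ratio_sqr_le.
rewrite qS => h; rewrite mulrC ler_pdivrMr//; apply: le_trans h _.
have : (n - 2) * S <= n - 2 by rewrite ler_piMr//; lra.
move=> /(ler_wpM2l L0); lra.
Qed.

(** The bracket on the right is nonnegative, so a smaller factor suffices: [2 + ln y] for [y >= 1],
    by the Padé bound, and 4 for [y < 1], by squaring [z (1 - ln z) <= 1] at [z = sqrt y]. With
    [L = ln n] and [y = n p] it says that [p ln^2 p] lies below its tangent at [p = 1 / n]. *)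
Lemma xln2x_tangent {R : realType} (L y : R) : 2 <= L -> 0 < y -> ln y <= L ->
  y * ln y ^+ 2 <= 2 * L * (y * ln y - y + 1).
Proof.
move=> L2 y0; set s := ln y => sL.
have [y1|y1] := leP 1 y.
  have s0 : 0 <= s by apply: ln_ge0.
  have h : 2 * (y - 1) <= s * (y + 1).
    by rewrite -ler_pdivrMr; [exact: ln_ge_pade|lra].
  have h0 : 0 <= y * s - y + 1.
    by have := xlnx_tangent y 1 (ltW y0) ltr01; rewrite ln1 -/s; lra.
  have h1 : y * s ^+ 2 <= (2 + s) * (y * s - y + 1) by rewrite expr2; lra.
  by apply: le_trans h1 _; apply: ler_wpM2r => //; lra.
pose z := Num.sqrt y; have z0 : 0 < z by rewrite sqrtr_gt0.
have yE : y = z ^+ 2 by rewrite sqr_sqrtr// ltW.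
have sE : s = ln z *+ 2 by rewrite /s yE lnXn.
have h : z * (1 - s / 2) <= 1.
  by have := xlnx_tangent z 1 (ltW z0) ltr01; rewrite ln1 sE; lra.
have s0 : s <= 0 by apply: ln_le0; lra.
have h2 : y * (1 - s / 2) ^+ 2 <= 1.
  by rewrite yE -exprMn expr_le1// mulr_ge0 ?ltW//; lra.
have h3 : y * s ^+ 2 <= 4 * (y * s - y + 1) by move: h2; rewrite !expr2; lra.
have h4 : 0 <= y * s - y + 1.
  have : 0 <= y * s ^+ 2 by rewrite mulr_ge0 ?sqr_ge0// ltW.
  by lra.
by apply: le_trans h3 _; apply: ler_wpM2r => //; lra.
Qed.

(** The second moment alone is at most [L^2]: the tangents at the uniform value [1 / n] are summed,
    and the squared mean is dropped. *)
Lemma logvar_le_tangent {R : realType} {I : finType} (p : I -> R) :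
  2 <= ln (#|I|%:R : R) -> (forall i, 0 <= p i) -> \sum_i p i = 1 ->
  logvar p <= ln #|I|%:R ^+ 2.
Proof.
set n : R := #|I|%:R; set L := ln n => L2 p0 p1.
have n0 : 0 < n by rewrite ltNge; apply/negP => /(@ln0 R) E; move: L2; rewrite /L E; lra.
have H i : p i * ln (p i) ^+ 2 <= (L ^+ 2 - 2 * L) * p i + 2 * L / n.
  have := p0 i; rewrite le_eqVlt => /predU1P[<-|pi0].
    by rewrite mul0r mulr0 add0r divr_ge0 ?(ltW n0)//; lra.
  have pi1 : p i <= 1 by rewrite -p1 (bigD1 i)//= lerDl sumr_ge0.
  have yn0 : 0 < p i * n by rewrite mulr_gt0.
  have lE : ln (p i * n) = ln (p i) + L by rewrite lnM.
  have := xln2x_tangent L _ L2 yn0; rewrite lE gerDr ln_le0//.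
  move=> /(_ isT) h; rewrite -(ler_pM2r n0) mulrDl divfK ?gt_eqF//.
  by move: h; rewrite !expr2; lra.
rewrite /logvar; apply: le_trans (_ : \sum_i p i * ln (p i) ^+ 2 <= _).
  by rewrite gerBl sqr_ge0.
apply: le_trans (ler_sum _ (fun i _ => H i)) _.
rewrite big_split /= -mulr_sumr p1 sumr_const -[_ *+ #|_|]mulr_natr -/n divfK ?gt_eqF//.
by rewrite mulr1 subrK.
Qed.

Lemma ln_nat_ge {R : realType} (d k m : nat) : (0 < d)%N -> (2 ^ m <= d ^ k)%N ->
  m%:R * ln 2 <= k%:R * ln (d%:R : R).
Proof.
move=> d0 h; rewrite !mulr_natl -!lnXn ?ltr0n// ler_ln ?posrE ?exprn_gt0 ?ltr0n//.
by rewrite -!natrX ler_nat.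
Qed.

Lemma logvar_le_ln_card_sqr {R : realType} {I : finType} (p : I -> R) :
  (1 < #|I|)%N -> (forall i, 0 <= p i) -> \sum_i p i = 1 ->
  logvar p <= ln #|I|%:R ^+ 2.
Proof.
(* From 9 entries on, [ln #|I| >= 2 ln 3 >= 2] and the tangent bound applies; smaller sizes use the
   pair bound. *)
move=> cI p0 p1; have [c9|c9] := leqP 9 #|I|.
  apply: logvar_le_tangent => //.
  have : ln (9 : R) <= ln #|I|%:R by rewrite ler_ln ?posrE ?ltr0n ?ler_nat ?(ltnW cI).
  have -> : 9 = 3 ^+ 2 :> R by rewrite -natrX.
  have : 1 <= ln (3 : R).
    by apply: le_trans (ln_ge_pade 3 _); rewrite ?ler_pdivlMr//; lra.
  by rewrite lnXn ?ltr0n//; lra.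
apply: le_trans (logvar_le_pairs p cI p0 p1) _.
have l2 : 0 <= ln (2 : R) by have := @ln2_ge R; lra.
(* [2 ^ m <= n ^ k] gives [ln n >= (m / k) ln 2]. *)
have H k m : (0 < k)%N -> (k ^ 2 * (#|I| - 1) <= m ^ 2)%N -> (2 ^ m <= #|I| ^ k)%N ->
    (#|I|%:R - 1) * ln 2 ^+ 2 <= ln (#|I|%:R : R) ^+ 2.
  move=> k0 h1 h2; have k0' : 0 < k%:R ^+ 2 :> R by rewrite exprn_gt0 ?ltr0n.
  have h3 := @ln_nat_ge R _ _ _ (ltnW cI) h2.
  have h4 : k%:R ^+ 2 * (#|I|%:R - 1) <= m%:R ^+ 2 :> R.
    by rewrite -(natrB _ (ltnW cI)) -!natrX -natrM ler_nat.
  rewrite -(ler_pM2l k0') mulrA; apply: le_trans (ler_wpM2r (sqr_ge0 (ln 2)) h4) _.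
  have mn0 : 0 <= m%:R * ln (2 : R) by rewrite mulr_ge0.
  by rewrite -!exprMn lerXn2r ?nnegrE// (le_trans mn0).
(* The sizes [n] from 2 to 8 remain. Each pair [k], [m] gives a fraction [m / k] between
   [sqrt (n - 1)] and the base-2 logarithm of [n]. *)
move: cI c9 H; case: #|I| => [|[|[|[|[|[|[|[|[|]]]]]]]]]// _ _ H.
- exact: (H 1 1).
- exact: (H 2 3).
- exact: (H 1 2).
- exact: (H 1 2).
- exact: (H 2 5).
- exact: (H 2 5).
- exact: (H 1 3).
Qed.

(** * Comparison with the geometric law, adding entries one at a time *)

(** For [a b > 0] the left side is at most [geom_var (a b)], hence at most the tangent at [N]
    evaluated at [gfun (a b)], which the entropy gain dominates. One tangent point [N] serves all
    additions, so that the bounds can be summed. *)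
Lemma mul_ln_sqr_le_geom {R : realType} (N a b : R) : 0 < N ->
  0 <= a <= 1 -> 0 <= b -> a + b <= 1 ->
  a * b * ln a ^+ 2 <=
  geom_slope N * ((a + b) * ln (a + b) - a * ln a - b * ln b) +
  (geom_var N - geom_slope N * gfun N).
Proof.
move=> N0 /andP[a0 a1] b0 ab; set C := geom_var N - _.
have C0 : 0 <= C by rewrite subr_ge0 geom_var_ge_slope.
have h := ler_wpM2l (geom_slope_ge0 N N0) (gfun_mul_le a b a0 b0 ab).
have [ab0|ab0] := eqVneq (a * b) 0.
  by move: h; rewrite ab0 gfun0 mul0r mulr0 => h; apply: addr_ge0.
have abp : 0 < a * b by rewrite lt_def ab0 mulr_ge0.
have aba : a * b <= a by rewrite ler_piMr//; lra.
have := geom_var_ge _ a abp aba a1.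
by have := geom_var_tangent N (a * b) N0 abp; rewrite /C; lra.
Qed.

(** Variance and entropy are left unnormalised, so that adding a head [x] to a tail [t] of mass [Q]
    increases the left side by exactly [x] times the sum of [y (ln x - ln y)^2], and the entropy by
    the gain of joining [x] and [Q]. A single entry contributes zero to both, hence [(size s).-1]
    constants. *)
Lemma seq_logvar_le {R : realType} (N : R) (s : seq R) : 0 < N -> s != [::] ->
  sorted <=%R s -> all (>= 0) s -> \sum_(y <- s) y <= 1 ->
  (\sum_(y <- s) y) * (\sum_(y <- s) y * ln y ^+ 2) - (\sum_(y <- s) y * ln y) ^+ 2
  <= geom_slope N *
       ((\sum_(y <- s) y) * ln (\sum_(y <- s) y) - \sum_(y <- s) y * ln y)
     + (size s).-1%:R * (geom_var N - geom_slope N * gfun N).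
Proof.
move=> N0; set k := geom_slope N; set C := geom_var N - _.
elim: s => [//|x [|x' s] IH _ sxs /andP[x0 s0]].
  by move=> _; rewrite !big_seq1 /= mul0r subrr mulr0 addr0 le_eqVlt;
     apply/orP; left; apply/eqP; ring.
move: sxs => /=; rewrite -/(sorted _ (x' :: s)) => /andP[xx' ss].
have {}s0 : all (>= 0) (x' :: s) := s0.
set t := x' :: s in IH s0 ss *; rewrite !(big_cons _ _ x).
set Q := \sum_(y <- t) y; set A := \sum_(y <- t) _ * _ ^+ 2.
set B := \sum_(y <- t) _ * _ => Q1.
have tx y : y \in t -> x <= y.
  move=> yt; have : sorted <=%R (x :: t) by rewrite /= xx'.
  by move=> /(order_path_min le_trans)/allP; apply.
have t0 y : y \in t -> 0 <= y by move=> /(allP s0).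
have Q0 : 0 <= Q by rewrite /Q big_seq sumr_ge0.
have yQ y : y \in t -> y <= Q.
  move=> yt; rewrite /Q (big_rem y yt) lerDl big_seq sumr_ge0// => z /mem_rem.
  exact: t0.
have := IH isT ss s0; rewrite -/Q -/A -/B => /(_ ltac:(lra)) IHt.
(* The order matters here: [x] is the smallest entry, so [ln x <= ln y <= 0]. *)
have step : x * \sum_(y <- t) y * (ln x - ln y) ^+ 2 <= x * Q * ln x ^+ 2.
  have [->|xN0] := eqVneq x 0; first by rewrite !mul0r.
  have xp : 0 < x by rewrite lt_def xN0.
  rewrite -mulrA; apply: ler_wpM2l => //; rewrite /Q mulr_suml.
  rewrite big_seq [leRHS]big_seq; apply: ler_sum => y yt.
  apply: ler_wpM2l; first exact: t0.
  have lxy : ln x <= ln y by rewrite ler_ln ?posrE ?tx// (lt_le_trans xp)// tx.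
  have ly : ln y <= 0 by rewrite ln_le0// (le_trans (yQ _ yt)); lra.
  by rewrite -subr_ge0 !expr2; nra.
have sumE : \sum_(y <- t) y * (ln x - ln y) ^+ 2 = ln x ^+ 2 * Q - 2 * ln x * B + A.
  rewrite /Q /A /B !mulr_sumr -sumrB -big_split /=; apply: eq_bigr => y _; ring.
have geo := mul_ln_sqr_le_geom N x Q N0 (_ : 0 <= x <= 1) Q0 Q1.
have {}geo := geo ltac:(rewrite x0; lra).
have -> : (size (x :: t)).-1%:R = (size t).-1%:R + 1 :> R by rewrite -natr1.
rewrite sumE in step; rewrite -/k -/C in geo.
have := lerD IHt (le_trans step geo).
by rewrite mulrDl mul1r; lra.
Qed.

Lemma logvar_le_geom {R : realType} {I : finType} (p : I -> R) (N : R) :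
  0 < N -> (0 < #|I|)%N -> (forall i, 0 <= p i) -> \sum_i p i = 1 ->
  logvar p <= - (geom_slope N * \sum_i p i * ln (p i)) +
    (#|I|%:R - 1) * (geom_var N - geom_slope N * gfun N).
Proof.
move=> N0 I0 p0 p1; pose s := sort <=%R [seq p i | i <- enum I].
have sE (F : R -> R) : \sum_(y <- s) F y = \sum_i F (p i).
  by rewrite /s (perm_big [seq p i | i <- enum I]) ?perm_sort//= big_map big_enum.
have := @seq_logvar_le R N s N0; rewrite !sE p1 ln1 !mul1r sub0r mulrN.
have -> : size s = #|I| by rewrite size_sort size_map -cardE.
rewrite -subn1 natrB//; apply => //.
- by rewrite -size_eq0 size_sort size_map -cardE -lt0n.
- by apply: sort_sorted; exact: le_total.
- by rewrite all_sort all_map; apply/allP => i _ /=.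
Qed.

(** The tangent point is the [N] with [gfun N = c H]. Multiplied by [c], the [#|I| - 1] nonnegative
    constants amount to at most one, and the tangent at its own point returns [geom_var N]. *)
Lemma mul_logvar_le {R : realType} {I : finType} (p : I -> R) (c N : R) :
  (1 < #|I|)%N -> (forall i, 0 <= p i) -> \sum_i p i = 1 ->
  0 <= c <= 1 / (#|I|%:R - 1) -> 0 < N ->
  gfun N = c * - \sum_i p i * ln (p i) -> c * logvar p <= geom_var N.
Proof.
move=> I1 p0 p1 /andP[c0 c1] N0 gN.
have n1 : 0 < #|I|%:R - 1 :> R by rewrite subr_gt0 ltr1n.
move: c1; rewrite ler_pdivlMr// => c1.
have C0 : 0 <= geom_var N - geom_slope N * gfun N by rewrite subr_ge0 geom_var_ge_slope.
have := ler_wpM2l c0 (logvar_le_geom p N N0 (ltnW I1) p0 p1).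
have := ler_wpM2r C0 c1.
rewrite mul1r; move: gN C0; set C := geom_var N - _; set S := \sum_i _.
move=> gN C0 h1 /le_trans; apply.
have : geom_slope N * gfun N = geom_slope N * (c * - S) by rewrite gN.
by have : C = geom_var N - geom_slope N * gfun N by []; lra.
Qed.

(** * The functions [gfun] and [gfun_inv] *)

(** On nonpositive reals [ln] is 0 by convention, so at 0 only the right side matters. There, with
    [y = z^2], [y ln y = 2 z (z ln z) >= 2 z (z - 1) >= - 2 z]. *)
Lemma continuous_xlnx {R : realType} : continuous (fun x : R => x * ln x).
Proof.
move=> x; have [x0|x0|->] := ltgtP x 0.
- apply/cvgrPdist_lt => e e0; near=> y.
  by rewrite !ln0 ?mulr0 ?subrr ?normr0// ltW//; near: y; exact: lt_nbhsl.
- by apply: cvgM; [exact: cvg_id|exact: continuous_ln].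
apply/cvgrPdist_le => e e0; near=> y.
rewrite mul0r sub0r normrN; have [y0|y0] := leP y 0.
  by rewrite ln0// mulr0 normr0 ltW.
pose z := Num.sqrt y; have z0 : 0 < z by rewrite sqrtr_gt0.
have yE : y = z ^+ 2 by rewrite sqr_sqrtr// ltW.
have ylt : y < Num.min 1 ((e / 2) ^+ 2).
  by near: y; apply: lt_nbhsl; rewrite lt_min ltr01 exprn_gt0// divr_gt0.
move: ylt; rewrite lt_min => /andP[y1 ye].
have ze : z <= e / 2.
  by rewrite -(@ler_pXn2r _ 2) ?nnegrE -?yE ?(ltW ye) ?(ltW z0)// divr_ge0 ?(ltW e0).
rewrite ler0_norm; last by rewrite mulr_ge0_le0 ?(ltW y0)// ln_le0// ltW.
have -> : y * ln y = 2 * (z * (z * ln z)) by rewrite yE lnXn//; ring.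
have h : z - 1 <= z * ln z by have := xlnx_tangent z 1 (ltW z0) ltr01; rewrite ln1; lra.
have := ler_wpM2l (ltW z0) h; have := mulr_ge0 (ltW z0) (ltW z0); lra.
Unshelve. all: by end_near. Qed.

Lemma continuous_gfun {R : realType} : continuous (@gfun R).
Proof.
move=> x; apply: cvgB; last exact: continuous_xlnx.
apply: (@continuous_comp _ _ _ (fun y : R => y + 1) (fun y => y * ln y)).
  by apply: cvgD; [exact: cvg_id|exact: cvg_cst].
exact: continuous_xlnx.
Qed.

Lemma gfun_gt0 {R : realType} (x : R) : 0 < x -> 0 < gfun x.
Proof.
move=> x0; have -> : gfun x = ln (x + 1) + x * dgfun x by rewrite /gfun /dgfun; ring.
by apply: ltr_wpDl; [apply: ln_ge0; lra|rewrite mulr_gt0 ?dgfun_gt0].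
Qed.

Lemma ltr_gfun {R : realType} (x y : R) : 0 <= x -> x < y -> gfun x < gfun y.
Proof.
rewrite le_eqVlt => /predU1P[<- y0|x0 xy]; first by rewrite gfun0 gfun_gt0.
have [|z /andP[xz zy] E] := @mean_value R (@gfun R) dgfun x y xy.
  by move=> z /andP[xz zy]; apply: is_derive_gfun; lra.
rewrite -subr_gt0 E; apply: mulr_gt0; last by rewrite subr_gt0.
by apply: dgfun_gt0; lra.
Qed.

Lemma ler_gfun {R : realType} (x y : R) : 0 <= x -> 0 <= y ->
  (gfun x <= gfun y) = (x <= y).
Proof.
move=> x0 y0; case: (ltgtP x y) => [xy|yx|->]; last exact: lexx.
- by rewrite ltW// ltr_gfun.
- by rewrite leNgt ltr_gfun.
Qed.

Lemma gfun_surj {R : realType} (y : R) : 0 <= y -> exists2 x, 0 <= x & gfun x = y.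
Proof.
(* This endpoint satisfies [ln (b + 1) = y], and [gfun b >= ln (b + 1)]. *)
move=> y0; pose b := expR y - 1.
have b0 : 0 <= b by rewrite subr_ge0 -expR0 ler_expR.
have yb : y <= gfun b.
  have [b1|b1] := eqVneq b 0.
    have : expR y = expR 0 by rewrite expR0; move: b1; rewrite /b; lra.
    by move=> /expR_inj ->; rewrite b1 gfun0.
  have bp : 0 < b by rewrite lt_def b1.
  have -> : gfun b = ln (b + 1) + b * dgfun b by rewrite /gfun /dgfun; ring.
  by rewrite subrK expRK lerDl mulr_ge0// ltW// dgfun_gt0.
have [||x] := @IVT R (@gfun R) 0 b y b0.
- by apply: continuous_subspaceT; exact: continuous_gfun.
- by rewrite gfun0 ge_min y0/= le_max yb orbT.
by rewrite in_itv => /andP[x0 _] <-; exists x.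
Qed.

Lemma gfun_inv_spec {R : realType} (y : R) : 0 <= y ->
  0 <= gfun_inv y /\ gfun (gfun_inv y) = y.
Proof.
move=> y0; pose A := [set x : R | 0 <= x].
have yA : (@gfun R @` A) y by have [x x0 <-] := gfun_surj y y0; exists x.
split; last by rewrite /gfun_inv pinvK// inE.
have H : set_surj A (@gfun R @` A) (@gfun R) by [].
by apply: (@surjpinv_image_sub _ _ (fun=> 0) _ _ _ H (gfun_inv y)); exists y.
Qed.

Lemma gfun_invK {R : realType} (x : R) : 0 <= x -> gfun_inv (gfun x) = x.
Proof.
move=> x0; have g0 : 0 <= gfun x by rewrite -gfun0 ler_gfun.
have [h E] := gfun_inv_spec _ g0.
by apply/eqP; rewrite eq_le -(ler_gfun _ _ h x0) -(ler_gfun _ _ x0 h) E lexx.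
Qed.

Lemma ler_gfun_inv {R : realType} (x y : R) : 0 <= x -> x <= y ->
  gfun_inv x <= gfun_inv y.
Proof.
move=> x0 xy; have [h1 E1] := gfun_inv_spec _ x0.
by have [h2 E2] := gfun_inv_spec _ (le_trans x0 xy); rewrite -ler_gfun// E1 E2.
Qed.

(* [gfun_inv] made constant on the negative reals, hence continuous on [R]. *)
Definition gfun_inv_ext {R : realType} (y : R) : R := gfun_inv (Num.max 0 y).

Lemma gfun_inv_ext_ge0 {R : realType} (y : R) : 0 <= gfun_inv_ext y.
Proof. by have [] := @gfun_inv_spec R (Num.max 0 y); rewrite ?le_max ?lexx. Qed.

Lemma gfun_inv_extE {R : realType} (y : R) : 0 <= y -> gfun_inv_ext y = gfun_inv y.
Proof. by move=> y0; rewrite /gfun_inv_ext max_r. Qed.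

Lemma gfun_inv_ext_le {R : realType} (x y : R) : 0 <= x ->
  (gfun_inv_ext y <= x) = (y <= gfun x).
Proof.
move=> x0; have [] := @gfun_inv_spec R (Num.max 0 y); first by rewrite le_max lexx.
rewrite -/(gfun_inv_ext y) => h E; rewrite -ler_gfun// E ge_max -{1}(@gfun0 R).
by rewrite ler_gfun// x0.
Qed.

(** Here [x] must be positive: at 0 the left side always holds, while the right side fails for
    negative [y]. With the preceding lemma it turns bounds on the inverse into bounds on its
    argument, which gives continuity. *)
Lemma le_gfun_inv_ext {R : realType} (x y : R) : 0 < x ->
  (x <= gfun_inv_ext y) = (gfun x <= y).
Proof.
move=> x0; have [] := @gfun_inv_spec R (Num.max 0 y); first by rewrite le_max lexx.
rewrite -/(gfun_inv_ext y) => h E; rewrite -ler_gfun ?(ltW x0)// E le_max.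
by rewrite [gfun x <= 0]leNgt gfun_gt0.
Qed.

Lemma continuous_gfun_inv_ext {R : realType} : continuous (@gfun_inv_ext R).
Proof.
move=> y; apply/cvgrPdist_lt => e e0; set x := gfun_inv_ext y.
have x0 : 0 <= x := gfun_inv_ext_ge0 y.
have up : \forall z \near y, gfun_inv_ext z < x + e.
  near=> z; rewrite ltNge le_gfun_inv_ext -?ltNge; last by lra.
  near: z; apply: lt_nbhsl; rewrite ltNge -le_gfun_inv_ext -?ltNge -/x; lra.
have lo : \forall z \near y, x - e < gfun_inv_ext z.
  have [xe|xe] := ltP (x - e) 0.
    by near=> z; rewrite (lt_le_trans xe)// gfun_inv_ext_ge0.
  suff : \forall z \near y, gfun (x - e) < z.
    by apply: filterS => z; rewrite [x - e < _]ltNge gfun_inv_ext_le// -ltNge.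
  by apply: lt_nbhsr; rewrite ltNge -gfun_inv_ext_le// -ltNge -/x; lra.
near=> z; rewrite distrC ltr_norml ltrBlDl ltrBrDl; apply/andP; split; near: z.
  exact: lo.
exact: up.
Unshelve. all: by end_near. Qed.

Lemma is_derive_gfun_inv_ext {R : realType} (y : R) : 0 < y ->
  is_derive y 1 (@gfun_inv_ext R) (dgfun (gfun_inv_ext y))^-1.
Proof.
move=> y0; have [] := gfun_inv_spec _ (ltW y0).
rewrite -gfun_inv_extE ?(ltW y0)//; set x := gfun_inv_ext y => x0 gx.
have xp : 0 < x.
  rewrite lt_def x0 andbT; apply: contraTneq y0 => xz.
  by rewrite -gx xz gfun0 ltxx.
rewrite -gx; apply: (@is_derive_inverse _ (@gfun R)).
- near=> z; have z0 : 0 < z by near: z; exact: lt_nbhsr.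
  rewrite gfun_inv_extE ?gfun_invK ?(ltW z0)//.
  by rewrite ltW// gfun_gt0.
- by near=> z; exact: continuous_gfun.
- exact: is_derive_gfun.
- by rewrite gt_eqF// dgfun_gt0.
Unshelve. all: by end_near. Qed.

(** * Concavity along a segment of probability vectors *)

(** Derivatives are required only inside the interval, as entries of a mixture may vanish at its
    ends. The slopes on both sides of [t] are values of [df] at [u < v], and [df] does not
    increase. *)
Lemma concave_of_derive2 {R : realType} {f df ddf : R -> R} : continuous f ->
  (forall s : R, 0 < s < 1 -> is_derive s 1 f (df s)) ->
  (forall s : R, 0 < s < 1 -> is_derive s 1 df (ddf s)) ->
  (forall s : R, 0 < s < 1 -> ddf s <= 0) ->
  forall t, 0 <= t <= 1 -> t * f 1 + (1 - t) * f 0 <= f t.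
Proof.
move=> fC fD dfD ddf0 t /andP[].
rewrite le_eqVlt => /predU1P[<- _|t0]; first by rewrite mul0r add0r subr0 mul1r.
rewrite le_eqVlt => /predU1P[->|t1]; first by rewrite subrr mul0r addr0 mul1r.
have [||u] := @MVT R f df 0 t t0.
- by move=> s; rewrite in_itv/= => /andP[s0 st]; apply: fD; rewrite s0 (lt_trans st).
- exact: continuous_subspaceT.
rewrite in_itv/= => /andP[u0 ut] Eu.
have [||v] := @MVT R f df t 1 t1.
- by move=> s; rewrite in_itv/= => /andP[st s1]; apply: fD; rewrite (lt_trans t0).
- exact: continuous_subspaceT.
rewrite in_itv/= => /andP[tv v1] Ev.
have uv : u < v := lt_trans ut tv.
have [s /andP[us sv]|s /andP[us sv] Es] := @mean_value R df ddf u v uv.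
  by apply: dfD; rewrite (lt_le_trans u0)// (le_lt_trans sv).
have dfuv : df v <= df u.
  rewrite -subr_le0 Es mulr_le0_ge0 ?subr_ge0 ?(ltW uv)//.
  by apply: ddf0; rewrite (lt_trans u0)// (lt_trans sv).
have tt : 0 <= t * (1 - t) by rewrite mulr_ge0 ?(ltW t0)// subr_ge0 ltW.
have := ler_wpM2l tt dfuv; rewrite subr0 in Eu.
have -> : f 1 = f t + df v * (1 - t) by rewrite -Ev; ring.
have -> : f 0 = f t - df u * t by rewrite -Eu; ring.
lra.
Qed.

Lemma is_derive_sum_fun {R : realType} n (h : 'I_n -> R -> R) (dh : 'I_n -> R) (x : R) :
  (forall i, is_derive x 1 (h i) (dh i)) ->
  is_derive x 1 (fun y => \sum_i h i y) (\sum_i dh i).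
Proof.
move=> hD; rewrite (_ : (fun y => _) = \sum_i h i); first exact: is_derive_sum.
by apply/funext => y; rewrite fct_sumE.
Qed.

Lemma continuous_sum_fun {R : realType} n (h : 'I_n -> R -> R) :
  (forall i, continuous (h i)) -> continuous (fun y => \sum_i h i y).
Proof.
move=> hC; elim: n h hC => [h _|n IH h hC] x.
  rewrite (_ : (fun y => _) = cst 0); first exact: cvg_cst.
  by apply/funext => y; rewrite big_ord0.
rewrite (_ : (fun y => _) = (fun y => h ord0 y + \sum_i h (lift ord0 i) y)).
  by apply: cvgD; [exact: hC|apply: IH => i; exact: hC].
by apply/funext => y; rewrite big_ord_recl.
Qed.

(** Lagrange's identity: the nonnegative double sum equals [2 (A C - B^2)]. *)
Lemma weighted_cauchy_schwarz {R : realType} {I : finType} (w x y : I -> R) :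
  (forall i, 0 <= w i) ->
  (\sum_i w i * (x i * y i)) ^+ 2 <=
  (\sum_i w i * x i ^+ 2) * (\sum_i w i * y i ^+ 2).
Proof.
move=> w0; set A := \sum_i w i * x i ^+ 2; set C := \sum_i w i * y i ^+ 2.
set B := \sum_i _.
have : 0 <= \sum_i \sum_j w i * w j * (x i * y j - x j * y i) ^+ 2.
  apply: sumr_ge0 => i _; apply: sumr_ge0 => j _.
  by apply: mulr_ge0; [exact: mulr_ge0|exact: sqr_ge0].
have -> : \sum_i \sum_j w i * w j * (x i * y j - x j * y i) ^+ 2 =
    \sum_i (w i * x i ^+ 2 * C - 2 * B * (w i * (x i * y i)) + w i * y i ^+ 2 * A).
  apply: eq_bigr => i _.
  have -> : 2 * B * (w i * (x i * y i)) = 2 * (w i * (x i * y i)) * B by ring.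
  rewrite /A /B /C !mulr_sumr -sumrB -big_split /=.
  by apply: eq_bigr => j _; ring.
rewrite big_split sumrB /= -!mulr_suml -mulr_sumr -/A -/B -/C => h.
by rewrite expr2; lra.
Qed.

(** * Shannon entropy along a segment and the concavity criterion *)

Definition shannon {R : realType} {d : nat} (p : 'I_d -> R) : R :=
  - \sum_i p i * ln (p i).

Definition is_dist {R : realType} {d : nat} (p : 'I_d -> R) : Prop :=
  (forall i, 0 <= p i) /\ \sum_i p i = 1.

Definition mix {R : realType} {d : nat} (t : R) (q r : 'I_d -> R) : 'I_d -> R :=
  fun i => t * q i + (1 - t) * r i.

Lemma is_dist_mix {R : realType} {d : nat} (t : R) (q r : 'I_d -> R) :
  0 <= t <= 1 -> is_dist q -> is_dist r -> is_dist (mix t q r).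
Proof.
move=> /andP[t0 t1] [q0 q1] [r0 r1]; split=> [i|].
  by rewrite addr_ge0 ?mulr_ge0 ?subr_ge0.
by rewrite big_split /= -!mulr_sumr q1 r1; ring.
Qed.

Lemma is_dist_le1 {R : realType} {d : nat} (p : 'I_d -> R) i : is_dist p -> p i <= 1.
Proof. by move=> [p0 p1]; rewrite -p1 (bigD1 i)//= lerDl sumr_ge0. Qed.

Lemma shannon_ge0 {R : realType} {d : nat} (p : 'I_d -> R) :
  is_dist p -> 0 <= shannon p.
Proof.
move=> pd; rewrite oppr_ge0 sumr_le0// => i _.
by rewrite mulr_ge0_le0 ?pd.1// ln_le0// is_dist_le1.
Qed.

Lemma shannon_gt0 {R : realType} {d : nat} (p : 'I_d -> R) i :
  is_dist p -> 0 < p i < 1 -> 0 < shannon p.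
Proof.
move=> pd pi01; rewrite oppr_gt0 (bigD1 i)//=.
apply: ltr_nwDl; first by rewrite pmulr_rlt0 ?ln_lt0//; case/andP: pi01.
by apply: sumr_le0 => j _; rewrite mulr_ge0_le0 ?pd.1// ln_le0// is_dist_le1.
Qed.

(** As [D] sums to 0, the constant 1 may be replaced by minus the mean of [ln p]. Cauchy-Schwarz
    with weights [p] then applies to [D / p] and the centred logarithm; indices with [p i = 0]
    contribute zero. *)
Lemma score_sqr_le {R : realType} {d : nat} (p D : 'I_d -> R) : is_dist p ->
  \sum_i D i = 0 -> (forall i, p i = 0 -> D i = 0) ->
  (\sum_i D i * (ln (p i) + 1)) ^+ 2 <= (\sum_i D i ^+ 2 / p i) * logvar p.
Proof.
move=> [p0 p1] D0 pD; set m := \sum_i p i * ln (p i).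
have -> : \sum_i D i * (ln (p i) + 1) = \sum_i p i * (D i / p i * (ln (p i) - m)).
  have -> : \sum_i D i * (ln (p i) + 1) = \sum_i (D i * ln (p i) - D i * m).
    under eq_bigr do rewrite mulrDr mulr1.
    by rewrite big_split sumrB /= -mulr_suml D0 mul0r subr0 addr0.
  apply: eq_bigr => i _; have [p00|pN0] := eqVneq (p i) 0.
    by rewrite p00 pD// !mul0r subrr.
  by field.
have -> : \sum_i D i ^+ 2 / p i = \sum_i p i * (D i / p i) ^+ 2.
  apply: eq_bigr => i _; have [p00|pN0] := eqVneq (p i) 0.
    by rewrite p00 pD// expr0n !mul0r.
  by field.
have -> : logvar p = \sum_i p i * (ln (p i) - m) ^+ 2; last exact: weighted_cauchy_schwarz.
rewrite (_ : \sum_i p i * (ln (p i) - m) ^+ 2 =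
   \sum_i (p i * ln (p i) ^+ 2 - 2 * m * (p i * ln (p i)) + m ^+ 2 * p i)).
  by rewrite big_split sumrB /= -!mulr_sumr p1 -/m /logvar -/m; ring.
by apply: eq_bigr => i _; ring.
Qed.

Lemma is_derive_mix {R : realType} {d : nat} (q r : 'I_d -> R) i (s : R) :
  is_derive s 1 (fun s : R => mix s q r i) (q i - r i).
Proof.
rewrite (_ : (fun s => _) = (fun s => (q i - r i) * s + r i)); last first.
  by apply/funext => u; rewrite /mix; ring.
apply: (is_derive_eq (is_deriveD
  (is_deriveZ (q i - r i) (is_derive_id s 1)) (is_derive_cst (r i) s 1))).
by rewrite addr0 /GRing.scale /= mulr1.
Qed.

(** Inside the segment an entry is thus either constant or positive, which is the case split in the
    derivatives below. *)
Lemma mix_gt0 {R : realType} {d : nat} (q r : 'I_d -> R) (s : R) i :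
  is_dist q -> is_dist r -> 0 < s < 1 -> q i != r i -> 0 < mix s q r i.
Proof.
move=> [q0 _] [r0 _] /andP[s0 s1] qr.
have /orP[qp|rp] : (0 < q i) || (0 < r i).
  rewrite !lt_def q0 r0 !andbT -negb_and; apply: contra qr => /andP[/eqP h1 /eqP h2].
  by rewrite h1 h2.
- by rewrite ltr_pwDl ?mulr_gt0// mulr_ge0// subr_ge0 ltW.
- by rewrite ltr_wpDl ?mulr_gt0 ?subr_gt0// mulr_ge0// ltW.
Qed.

Lemma is_derive_ln_mix {R : realType} {d : nat} (q r : 'I_d -> R) (s : R) i :
  0 < mix s q r i ->
  is_derive s 1 (fun s : R => ln (mix s q r i)) ((q i - r i) / mix s q r i).
Proof.
move=> p0; rewrite mulrC.
exact: (@is_derive1_comp _ (@ln R) _ s _ _ (is_derive1_ln p0) (is_derive_mix q r i s)).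
Qed.

Lemma mix_const {R : realType} {d : nat} (q r : 'I_d -> R) (s : R) i :
  q i = r i -> mix s q r i = r i.
Proof. by rewrite /mix => ->; ring. Qed.

Lemma is_derive_sum_mix_ln {R : realType} {d : nat} (q r : 'I_d -> R) (s : R) :
  is_dist q -> is_dist r -> 0 < s < 1 ->
  is_derive s 1 (fun s : R => \sum_i mix s q r i * ln (mix s q r i))
    (\sum_i (q i - r i) * (ln (mix s q r i) + 1)).
Proof.
move=> qd rd s01; apply: is_derive_sum_fun => i.
have [qr|qr] := eqVneq (q i) (r i).
  rewrite qr subrr mul0r (_ : (fun y => _) = cst (r i * ln (r i))).
    exact: is_derive_cst.
  by apply/funext => y; rewrite mix_const.
have p0 := mix_gt0 q r s i qd rd s01 qr.
apply: (is_derive_eq (is_deriveM (is_derive_mix q r i s) (is_derive_ln_mix q r s i p0))).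
by rewrite /GRing.scale /=; field; rewrite gt_eqF.
Qed.

Lemma is_derive_sum_ln_mix {R : realType} {d : nat} (q r : 'I_d -> R) (s : R) :
  is_dist q -> is_dist r -> 0 < s < 1 ->
  is_derive s 1 (fun s : R => \sum_i (q i - r i) * (ln (mix s q r i) + 1))
    (\sum_i (q i - r i) ^+ 2 / mix s q r i).
Proof.
move=> qd rd s01; apply: is_derive_sum_fun => i.
have [qr|qr] := eqVneq (q i) (r i).
  rewrite qr subrr expr0n mul0r (_ : (fun y => _) = cst 0).
    exact: is_derive_cst.
  by apply/funext => y; rewrite mul0r.
have p0 := mix_gt0 q r s i qd rd s01 qr.
apply: (is_derive_eq (is_deriveZ (q i - r i)
  (is_deriveD (is_derive_ln_mix q r s i p0) (is_derive_cst (1 : R) s 1)))).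
by rewrite /GRing.scale /= addr0; field; rewrite gt_eqF.
Qed.

Lemma continuous_shannon_mix {R : realType} {d : nat} (q r : 'I_d -> R) :
  continuous (fun s : R => shannon (mix s q r)).
Proof.
move=> s; apply: cvgN; apply: continuous_sum_fun => i {}s.
apply: (@continuous_comp _ _ _ (fun s : R => mix s q r i) (fun y => y * ln y)).
  apply: differentiable_continuous; apply/derivable1_diffP.
  exact: (@ex_derive _ _ _ _ _ _ _ (is_derive_mix q r i s)).
exact: continuous_xlnx.
Qed.

(** An entry where [q] and [r] differ lies strictly between 0 and 1: a mixture equal to 1 would
    force both to be 1. *)
Lemma shannon_mix_gt0 {R : realType} {d : nat} (q r : 'I_d -> R) (s : R) :
  is_dist q -> is_dist r -> q <> r -> 0 < s < 1 -> 0 < shannon (mix s q r).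
Proof.
move=> qd rd qr s01; have sd : is_dist (mix s q r).
  by apply: is_dist_mix => //; case/andP: s01 => s0 s1; rewrite !ltW.
have [i /eqP qri] : exists i, q i <> r i by apply/existsNP => h; apply: qr; apply/funext.
apply: (shannon_gt0 _ i) => //; rewrite mix_gt0//=.
rewrite lt_neqAle is_dist_le1// andbT; apply: contra qri => /eqP.
have := is_dist_le1 _ i qd; have := is_dist_le1 _ i rd.
case/andP: s01 => s0 s1; rewrite /mix => r1 q1 e.
have h1 : 0 <= s * (1 - q i) by rewrite mulr_ge0 ?subr_ge0// ltW.
have h2 : 0 <= (1 - s) * (1 - r i) by rewrite mulr_ge0 ?subr_ge0// ltW.
have /eqP : s * (1 - q i) = 0 by lra.
rewrite mulf_eq0 gt_eqF//= => /eqP q1'.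
have /eqP : (1 - s) * (1 - r i) = 0 by lra.
rewrite mulf_eq0 gt_eqF ?subr_gt0//= => /eqP r1'.
by apply/eqP; lra.
Qed.

(** Differentiability of [phi] at positive arguments is enough, because the entropy is positive
    inside a nondegenerate segment; the case [q = r] is treated apart. *)
Lemma shannon_comp_concave {R : realType} {d : nat} (phi dphi ddphi : R -> R)
  (q r : 'I_d -> R) (t : R) : continuous phi ->
  (forall y : R, 0 < y -> is_derive y 1 phi (dphi y)) ->
  (forall y : R, 0 < y -> is_derive y 1 dphi (ddphi y)) ->
  (forall y : R, 0 < y -> 0 <= ddphi y) ->
  (forall p : 'I_d -> R, is_dist p -> 0 < shannon p ->
     ddphi (shannon p) * logvar p <= dphi (shannon p)) ->
  is_dist q -> is_dist r -> 0 <= t <= 1 ->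
  t * phi (shannon q) + (1 - t) * phi (shannon r) <= phi (shannon (mix t q r)).
Proof.
move=> phiC phiD dphiD ddphi0 hV qd rd t01.
have [->|qr] := pselect (q = r).
  have -> : mix t r r = r by apply/funext => i; rewrite mix_const.
  by rewrite -mulrDl addrCA subrr addr0 mul1r.
have Hp s := shannon_mix_gt0 q r s qd rd qr.
have {1}-> : q = mix 1 q r by apply/funext => j; rewrite /mix; ring.
have {2}-> : r = mix 0 q r by apply/funext => j; rewrite /mix; ring.
pose D i := q i - r i.
pose dE s := \sum_i D i * (ln (mix s q r i) + 1).
pose ddE s := \sum_i D i ^+ 2 / mix s q r i.
have HD (s : R) : 0 < s < 1 -> is_derive s 1 (fun s : R => shannon (mix s q r)) (- dE s).
  by move=> s01; exact: (is_deriveN (is_derive_sum_mix_ln q r s qd rd s01)).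
have dHD (s : R) : 0 < s < 1 -> is_derive s 1 (fun s : R => - dE s) (- ddE s).
  by move=> s01; exact: (is_deriveN (is_derive_sum_ln_mix q r s qd rd s01)).
pose f s := phi (shannon (mix s q r)).
pose df s := dphi (shannon (mix s q r)) * - dE s.
pose ddf s := ddphi (shannon (mix s q r)) * dE s ^+ 2 - dphi (shannon (mix s q r)) * ddE s.
apply: (@concave_of_derive2 _ f df ddf) => //.
- move=> s; apply: (@continuous_comp _ _ _ (fun s : R => shannon (mix s q r)) phi).
    exact: continuous_shannon_mix.
  exact: phiC.
- move=> s s01.
  exact: (@is_derive1_comp _ phi _ s _ _ (phiD _ (Hp s s01)) (HD s s01)).
- move=> s s01.
  have H1 := @is_derive1_comp _ dphi _ s _ _ (dphiD _ (Hp s s01)) (HD s s01).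
  apply: (is_derive_eq (is_deriveM H1 (dHD s s01))).
  by rewrite /ddf /GRing.scale /= ?fctE /=; ring.
- move=> s s01; have sd : is_dist (mix s q r).
    by apply: is_dist_mix => //; case/andP: s01 => s0 s1; rewrite !ltW.
  have H0 := Hp s s01; have hVs := hV _ sd H0.
  have D0 : \sum_i D i = 0 by rewrite sumrB qd.2 rd.2 subrr.
  have CS : dE s ^+ 2 <= ddE s * logvar (mix s q r).
    apply: score_sqr_le => // j pj; apply/eqP; apply: contra_eqT pj => Dj.
    by rewrite gt_eqF// mix_gt0// -subr_eq0.
  have A0 : 0 <= ddE s.
    by apply: sumr_ge0 => j _; rewrite mulr_ge0 ?sqr_ge0// invr_ge0; exact: sd.1.
  (* [ddphi * dE^2 <= ddphi * ddE * logvar <= dphi * ddE]. *)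
  have := ler_wpM2l (ddphi0 _ H0) CS; have := ler_wpM2l A0 hVs; rewrite /ddf; lra.
Qed.

(** * From density matrices to probability vectors *)

Definition basis_diag {R : realType} {d : nat} (U A : 'M[R[i]]_d) (i : 'I_d) : R :=
  complex.Re ((U *m A *m U ^t*) i i).

Lemma hermsymmxE {R : realType} {d : nat} (A : 'M[R[i]]_d) :
  (A \is hermsymmx) = (A == A ^t*).
Proof. by rewrite qualifE expr0 scale1r. Qed.

Lemma psdmx_basis_diag_ge0 {R : realType} {d : nat} (U A : 'M[R[i]]_d) i :
  psdmx A -> 0 <= (U *m A *m U ^t*) i i.
Proof.
move=> [_ /(_ ((row i U) ^t*))]; rewrite trmxCK.
congr (_ <= _).
by rewrite -row_mul [LHS]mxE [RHS]mxE; apply: eq_bigr => j _; rewrite !mxE.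
Qed.

Lemma basis_diagE {R : realType} {d : nat} (U A : 'M[R[i]]_d) i :
  psdmx A -> (basis_diag U A i)%:C = (U *m A *m U ^t*) i i.
Proof. by move=> hA; rewrite RRe_real// ger0_real// psdmx_basis_diag_ge0. Qed.

Lemma is_dist_basis_diag {R : realType} {d : nat} (U A : 'M[R[i]]_d) :
  U \is unitarymx -> density A -> is_dist (basis_diag U A).
Proof.
move=> Uu [hA tA]; split=> [i|].
  by rewrite -ler0c basis_diagE// psdmx_basis_diag_ge0.
apply: complexI; rewrite rmorph_sum rmorph1 -tA.
have -> : \tr A = \tr (U *m A *m U ^t*).
  rewrite mxtrace_mulC mulmxA -(invmx_unitary Uu) mulVmx ?mul1mx//.
  exact: unitarymx_unit.
by apply: eq_bigr => i _; rewrite -basis_diagE.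
Qed.

Lemma spectral_conj {R : realType} {d : nat} (A : 'M[R[i]]_d) : A \is hermsymmx ->
  spectralmx A *m A *m (spectralmx A) ^t* = diag_mx (spectral_diag A).
Proof.
move=> /hermitian_normalmx/orthomx_spectralP AE.
have Pu := spectral_unitarymx A.
rewrite {2}AE -(invmx_unitary Pu) !mulmxA mulmxV ?unitarymx_unit// mul1mx.
by rewrite mulmxK// unitarymx_unit.
Qed.

Lemma basis_diag_spectral {R : realType} {d : nat} (A : 'M[R[i]]_d) i :
  A \is hermsymmx ->
  basis_diag (spectralmx A) A i = complex.Re (spectral_diag A ord0 i).
Proof. by move=> hA; rewrite /basis_diag spectral_conj// !mxE eqxx mulr1n. Qed.

Lemma vonNeumann_entropy_basis {R : realType} {d : nat} (A : 'M[R[i]]_d) :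
  A \is hermsymmx -> vonNeumann_entropy A = shannon (basis_diag (spectralmx A) A).
Proof.
by move=> hA; congr (- _); apply: eq_bigr => i _; rewrite basis_diag_spectral.
Qed.

Definition sqrmod {R : realType} (z : R[i]) : R := complex.Re z ^+ 2 + complex.Im z ^+ 2.

Lemma sqrmodE {R : realType} (z : R[i]) : (sqrmod z)%:C = z * z^*%C.
Proof. by rewrite add_Re2_Im2 sqr_normc. Qed.

Lemma sqrmod_ge0 {R : realType} (z : R[i]) : 0 <= sqrmod z.
Proof. by rewrite addr_ge0 ?sqr_ge0. Qed.

Lemma unitary_row_sum {R : realType} {d : nat} (W : 'M[R[i]]_d) i :
  W \is unitarymx -> \sum_j sqrmod (W i j) = 1.
Proof.
move=> /unitarymxP/matrixP/(_ i i) E; apply: complexI; rewrite rmorph_sum rmorph1.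
move: E; rewrite !mxE eqxx => E; apply: etrans E; apply: eq_bigr => j _.
by rewrite !mxE -sqrmodE.
Qed.

Lemma unitary_col_sum {R : realType} {d : nat} (W : 'M[R[i]]_d) j :
  W \is unitarymx -> \sum_i sqrmod (W i j) = 1.
Proof.
rewrite -trmx_unitary => /(unitary_row_sum _ j) <-.
by apply: eq_bigr => i _; rewrite mxE.
Qed.

(* The diagonal in one orthonormal basis is the doubly stochastic image
   [sqrmod (W i j)] of the spectrum, so convexity of [x ln x] applies rowwise. *)
Lemma vonNeumann_entropy_le_basis {R : realType} {d : nat} (U A : 'M[R[i]]_d) :
  U \is unitarymx -> density A -> vonNeumann_entropy A <= shannon (basis_diag U A).
Proof.
move=> Uu Ad; have [hA _] := Ad; have hh := hA.1.
rewrite (vonNeumann_entropy_basis A hh); set P := spectralmx A.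
have Pu : P \is unitarymx := spectral_unitarymx A.
pose l := basis_diag P A.
have [l0 _] : is_dist l by exact: is_dist_basis_diag.
pose W := U *m P ^t*.
have Pc : P ^t* \is unitarymx by rewrite trmxC_unitary.
have Wu : W \is unitarymx := mul_unitarymx Uu Pc.
have lE : U *m A *m U ^t* = W *m diag_mx (spectral_diag A) *m W ^t*.
  rewrite {1}(orthomx_spectralP (hermitian_normalmx hh)) (invmx_unitary Pu).
  by rewrite /W trmx_mul map_mxM trmxCK !mulmxA.
have qE i : basis_diag U A i = \sum_j sqrmod (W i j) * l j.
  apply: complexI; rewrite basis_diagE// lE rmorph_sum mxE.
  apply: eq_bigr => j _.
  rewrite rmorphM -[RHS]/((sqrmod (W i j))%:C * (l j)%:C) sqrmodE basis_diagE//.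
  by rewrite /P spectral_conj// mul_mx_diag !mxE eqxx mulr1n; ring.
rewrite lerN2.
have -> : \sum_j l j * ln (l j) = \sum_i \sum_j sqrmod (W i j) * (l j * ln (l j)).
  rewrite exchange_big; apply: eq_bigr => j _.
  by rewrite -mulr_suml (unitary_col_sum W j Wu) mul1r.
apply: ler_sum => i _; rewrite qE; apply: xlnx_jensen => //.
- by move=> j; exact: sqrmod_ge0.
- exact: unitary_row_sum.
Qed.

Lemma hermsymmx_mix {R : realType} {d : nat} (t : R) (x y : 'M[R[i]]_d) :
  x \is hermsymmx -> y \is hermsymmx ->
  t%:C *: x + (1 - t)%:C *: y \is hermsymmx.
Proof.
rewrite !hermsymmxE => /eqP/matrixP xE /eqP/matrixP yE; apply/eqP/matrixP => i j.
have Cr (s : R) : Num.conj (s%:C) = s%:C := conjc_real s.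
by rewrite !mxE [RHS](rmorphD Num.conj) !(rmorphM Num.conj) /= !Cr xE yE !mxE.
Qed.

Lemma basis_diag_mix {R : realType} {d : nat} (U x y : 'M[R[i]]_d) (t : R) :
  psdmx x -> psdmx y ->
  basis_diag U (t%:C *: x + (1 - t)%:C *: y) =
  mix t (basis_diag U x) (basis_diag U y).
Proof.
move=> xp yp; apply/funext => i; apply: complexI; rewrite /mix.
rewrite /basis_diag mulmxDr mulmxDl -!scalemxAr -!scalemxAl mxE mxE [X in _ + X]mxE.
by rewrite -!basis_diagE// -!rmorphM -rmorphD.
Qed.

Lemma entropy_concave_reduction {R : realType} {d : nat} (phi : R -> R)
    (x y : 'M[R[i]]_d) (t : R) :
  (forall a b : R, 0 <= a -> a <= b -> phi a <= phi b) ->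
  (forall q r : 'I_d -> R, is_dist q -> is_dist r ->
     t * phi (shannon q) + (1 - t) * phi (shannon r) <= phi (shannon (mix t q r))) ->
  density x -> density y -> 0 <= t <= 1 ->
  t * phi (vonNeumann_entropy x) + (1 - t) * phi (vonNeumann_entropy y) <=
  phi (vonNeumann_entropy (t%:C *: x + (1 - t)%:C *: y)).
Proof.
move=> phi_mono conc xd yd /andP[t0 t1]; set z := _ *: x + _.
have xh := xd.1.1; have yh := yd.1.1.
pose U := spectralmx z; have Uu : U \is unitarymx := spectral_unitarymx z.
have Hge0 A : density A -> 0 <= vonNeumann_entropy A.
  move=> Ad; rewrite vonNeumann_entropy_basis; last exact: Ad.1.1.
  apply: shannon_ge0; exact: is_dist_basis_diag (spectral_unitarymx _) Ad.
rewrite (vonNeumann_entropy_basis z) ?hermsymmx_mix//.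
rewrite basis_diag_mix; [|exact: xd.1|exact: yd.1].
apply: le_trans (conc _ _ (is_dist_basis_diag U x Uu xd) (is_dist_basis_diag U y Uu yd)).
apply: lerD; apply: ler_wpM2l; rewrite ?subr_ge0//; apply: phi_mono.
- exact: Hge0.
- exact: vonNeumann_entropy_le_basis.
- exact: Hge0.
- exact: vonNeumann_entropy_le_basis.
Qed.

(** * The criterion applied to the two functions *)

Lemma is_derive_scale {R : realType} (c y : R) : is_derive y 1 (fun y : R => c * y) c.
Proof.
by apply: (is_derive_eq (is_deriveZ c (is_derive_id y 1))); rewrite /GRing.scale /= mulr1.
Qed.

Lemma shannon_power_concave {R : realType} {d : nat} (c : R) (q r : 'I_d -> R) (t : R) :
  (1 < d)%N -> 0 <= c <= 1 / ln d%:R ^+ 2 -> is_dist q -> is_dist r -> 0 <= t <= 1 ->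
  t * expR (c * shannon q) + (1 - t) * expR (c * shannon r) <=
  expR (c * shannon (mix t q r)).
Proof.
move=> d1 /andP[c0 cd] qd rd t01.
have ln_d : 0 < ln (d%:R : R) by rewrite ln_gt0// ltr1n.
pose phi (y : R) := expR (c * y).
have phiD (y : R) : is_derive y 1 phi (c * phi y).
  rewrite mulrC; exact: (@is_derive1_comp _ (@expR R) _ y _ _
    (is_derive_expR _) (is_derive_scale c y)).
apply: (@shannon_comp_concave _ _ phi (fun y => c * phi y) (fun y => c * (c * phi y))) => //.
- move=> y; apply: differentiable_continuous; apply/derivable1_diffP.
  exact: (@ex_derive _ _ _ _ _ _ _ (phiD y)).
- by move=> y _; rewrite !mulr_ge0// expR_ge0.
- move=> p [p0 p1] _; rewrite -mulrA ler_wpM2l// mulrAC -[leRHS]mul1r.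
  apply: ler_wpM2r; first exact: expR_ge0.
  have := @logvar_le_ln_card_sqr R 'I_d p; rewrite card_ord => /(_ d1 p0 p1) V.
  apply: le_trans (ler_wpM2l c0 V) _.
  by move: cd; rewrite ler_pdivlMr// exprn_gt0.
Qed.

Lemma shannon_photon_concave {R : realType} {d : nat} (c : R) (q r : 'I_d -> R) (t : R) :
  (1 < d)%N -> 0 <= c <= 1 / (d%:R - 1) -> is_dist q -> is_dist r -> 0 <= t <= 1 ->
  t * gfun_inv (c * shannon q) + (1 - t) * gfun_inv (c * shannon r) <=
  gfun_inv (c * shannon (mix t q r)).
Proof.
move=> d1 c01 qd rd t01; have /andP[c0 _] := c01.
(* For [c = 0] the function is constant; otherwise [phi] is positive at positive arguments. *)
have [->|cN0] := eqVneq c 0; first by rewrite !mul0r -mulrDl addrCA subrr addr0 mul1r.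
have cp : 0 < c by rewrite lt_def cN0.
have H0 (p : 'I_d -> R) : is_dist p -> 0 <= c * shannon p.
  by move=> pd; rewrite mulr_ge0// shannon_ge0.
rewrite -!gfun_inv_extE ?H0//; last exact: is_dist_mix.
pose phi (y : R) := gfun_inv_ext (c * y).
pose dphi (y : R) := c * (dgfun (phi y))^-1.
(* Differentiating [c / dgfun (phi y)] brings in [1 / (phi (phi + 1) dgfun^2)], the inverse of
   [geom_var]; the criterion thus becomes [c * logvar p <= geom_var N] with
   [N = phi (shannon p)]. *)
pose ddphi (y : R) := c * (dphi y / (geom_var (phi y))).
have phi_gt0 (y : R) : 0 < y -> 0 < phi y.
  move=> y0; rewrite ltNge gfun_inv_ext_le// gfun0 -ltNge mulr_gt0//.
have phiD (y : R) : 0 < y -> is_derive y 1 phi (dphi y).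
  move=> y0; rewrite /dphi mulrC.
  exact: (@is_derive1_comp _ (@gfun_inv_ext R) _ y _ _
    (is_derive_gfun_inv_ext _ (mulr_gt0 cp y0)) (is_derive_scale c y)).
apply: (@shannon_comp_concave _ _ phi dphi ddphi) => //.
- move=> y; apply: (@continuous_comp _ _ _ (fun y : R => c * y) (@gfun_inv_ext R)).
    apply: differentiable_continuous; apply/derivable1_diffP.
    exact: (@ex_derive _ _ _ _ _ _ _ (is_derive_scale c y)).
  exact: continuous_gfun_inv_ext.
- move=> y y0; have N0 := phi_gt0 y y0; have L0 := dgfun_gt0 _ N0.
  have H1 := @is_derive1_comp _ dgfun _ y _ _ (is_derive_dgfun _ N0) (phiD y y0).
  have H2 := @is_deriveV _ (dgfun \o phi) y _ 1 (lt0r_neq0 L0) H1.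
  apply: (is_derive_eq (is_deriveZ c H2)).
  rewrite /ddphi /geom_var /dphi /GRing.scale /=; field.
  by rewrite !gt_eqF//; lra.
- move=> y y0; have N0 := phi_gt0 y y0; have L0 := dgfun_gt0 _ N0.
  rewrite /ddphi /geom_var /dphi !mulr_ge0 ?invr_ge0 ?(ltW L0)//.
  by rewrite !mulr_ge0 ?(ltW N0) ?sqr_ge0//; lra.
- move=> p pd p0; have N0 := phi_gt0 _ p0; have L0 := dgfun_gt0 _ N0.
  have := @mul_logvar_le R 'I_d p c (phi (shannon p)).
  rewrite card_ord => /(_ d1 pd.1 pd.2 c01 N0) V.
  have gN : gfun (phi (shannon p)) = c * shannon p.
    by rewrite /phi gfun_inv_extE ?H0//; case: (gfun_inv_spec _ (H0 _ pd)).
  have {}V := V gN.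
  have w0 : 0 < geom_var (phi (shannon p)).
    by rewrite /geom_var !mulr_gt0 ?exprn_gt0//; lra.
  have d0 : 0 <= dphi (shannon p) by rewrite mulr_ge0// invr_ge0 ltW.
  rewrite /ddphi.
  have -> : c * (dphi (shannon p) / geom_var (phi (shannon p))) * logvar p =
    dphi (shannon p) * ((c * logvar p) / geom_var (phi (shannon p))) by ring.
  by rewrite ler_piMr// ler_pdivrMr// mul1r.
Qed.

Theorem theorem6 (R : realType) (d : nat) (hd : (2 <= d)%N) :
  (forall c : R, 0 <= c <= 1 / ln d%:R ^+ 2 ->
     concave_on (@density R d) (entropy_power c)) /\
  (forall c : R, 0 <= c <= 1 / (d%:R - 1) ->
     concave_on (@density R d) (entropy_photon_number c)).
Proof.
split=> c c01 x y t xd yd t01.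
  apply: (@entropy_concave_reduction _ _ (fun h => expR (c * h))) => //.
    by move=> a b _ ab; rewrite ler_expR ler_wpM2l//; case/andP: c01.
  by move=> q r qd rd; apply: shannon_power_concave.
have c0 : 0 <= c by case/andP: c01.
apply: (@entropy_concave_reduction _ _ (fun h => gfun_inv (c * h))) => //.
  by move=> a b a0 ab; apply: ler_gfun_inv; rewrite ?mulr_ge0// ler_wpM2l.
by move=> q r qd rd; apply: shannon_photon_concave.
Qed.
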